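(* Let $d,p\ge 1$, let $\eta:\mathbb R^d\to\mathbb R$ be a measurable function, let $P_1,\dots,P_d$ be probability distributions on $\mathbb R$, let $\Theta\subset\mathbb R^p$ be a compact set, and let $(C_\theta)_{\theta\in\Theta}$ be a parametric family of $d$-dimensional copulas. For $\theta\in\Theta$, let $P_\theta$ be the distribution on $\mathbb R^d$ with marginals $P_1,\dots,P_d$ and copula $C_\theta$, i.e. with joint CDF $F_\theta(\mathbf x)=C_\theta(F_1(x_1),\dots,F_d(x_d))$ where $F_j$ is the CDF of $P_j$. Let $G_\theta$ be the CDF of $\eta(\mathbf X)$ when $\mathbf X\sim P_\theta$, and for a CDF $G$ put $G^{-1}(\alpha)=\inf\{y\in\mathbb R: G(y)\ge\alpha\}$. Fix $\alpha\in(0,1)$ and set ${G_C^{-1}}^\star(\alpha)=\inf_{\theta\in\Theta}G_\theta^{-1}(\alpha)$. Assume: (A1) for every $\theta\in\Theta$, $P_\theta$ has a density $f_\theta$ with respect to Lebesgue measure on $\mathbb R^d$, and $C_\theta$ has a density $c_\theta$ with respect to Lebesgue measure on $[0,1]^d$, such that $(\theta,\mathbf u)\mapsto c_\theta(\mathbf u)$ is continuous on $\Theta\times[0,1]^d$; (A2) for every $\theta\in\Theta$, $G_\theta$ is continuous; (A3) for every $\theta\in\Theta$, $G_\theta$ is strictly increasing, and there is a function $\underline{\epsilon}_\Theta:(0,\infty)\to(0,\infty)$ such that for all $\theta\in\Theta$ and all $\delta>0$, $\epsilon_{G_\theta}(\delta,G_\theta^{-1}(\alpha))\ge \underline{\epsilon}_\Theta(\delta)$,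 where $\epsilon_G(\delta,y):=\min\big(G(y+\delta)-G(y),\,G(y)-G(y-\delta)\big)$. Let $(\Theta_N)_{N\ge1}$ be finite subsets of $\Theta$ with $|\Theta_N|=N$ and $\sup_{\theta\in\Theta}\min_{\theta'\in\Theta_N}\|\theta-\theta'\|_2\to0$ as $N\to\infty$. Let $(N_n)_{n\ge1}$ be integers with $N_n\le K n^{\beta}$ for some constants $K,\beta>0$. For each $n$ and each $\theta\in\Theta_{N_n}$, let $\mathbf X_1,\dots,\mathbf X_n$ be i.i.d. with distribution $P_\theta$ (all samples defined on a common probability space), $Y_i=\eta(\mathbf X_i)$, $\widehat G_\theta(y)=\frac1n\sum_{i=1}^n\mathbf 1_{Y_i\le y}$ and $\widehat G_\theta^{-1}(\alpha)=\inf\{y:\widehat G_\theta(y)\ge\alpha\}$. Let $\hat\theta\in\operatorname{argmin}_{\theta\in\Theta_{N_n}}\widehat G_\theta^{-1}(\alpha)$. Then for every $\varepsilon>0$, $$\mathbb P\Big(\big|\widehat G_{\hat\theta}^{-1}(\alpha)-{G_C^{-1}}^\star(\alpha)\big|>\varepsilon\Big)\xrightarrow[n\to\infty]{}0.$$ Moreover, if in addition (A4) there is a unique $\theta_C^*\in\Theta$ minimizing $\theta\mapsto G_\theta^{-1}(\alpha)$, then for every $h>0$, $\mathbb P(\|\hat\theta-\theta_C^*\|>h)\to0$ as $n\to\infty$.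
   Context: A $d$-dimensional copula is a CDF on $[0,1]^d$ with uniform marginals. $\epsilon_G(\delta,y)$ is called the local modulus of increase of the CDF $G$ at $y$. The empirical quantiles for different grid points may be computed from different samples; the probability is taken over all samples jointly.
   Formalization: The condition N_n → ∞ is added (with N_n = 1 and Θ_1 = {θ_1}, θ_1 not a minimizer, the claim fails), and the estimator θ̂ is assumed measurable so that the probabilities are defined. *)

(* Defs.v *)
From HB Require Import structures.
From mathcomp Require Import all_boot all_order all_algebra.
From mathcomp Require Import all_classical all_reals all_analysis.
Set Implicit Arguments. Unset Strict Implicit. Unset Printing Implicit Defensive.
Import Order.TTheory GRing.Theory Num.Theory.
Import numFieldNormedType.Exports.
Local Open Scope classical_set_scope.
Local Open Scope ring_scope.

(** Points of R^d are represented as [d.-tuple R], which carries the product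
    (Borel) sigma-algebra [measure_tuple_display]. *)

(** Lebesgue integral on R^d of a function [g : d.-tuple R -> \bar R], written as
    the iterated one-dimensional Lebesgue integral
    int dx_0 int dx_1 ... int dx_{d-1} g(x_0,...,x_{d-1}).
    By Tonelli, for nonnegative measurable g this is the integral of g with
    respect to d-dimensional Lebesgue measure. *)
Fixpoint leb_int {R : realType} (d : nat) : (d.-tuple R -> \bar R) -> \bar R :=
  match d return (d.-tuple R -> \bar R) -> \bar R with
  | 0 => fun g => g [tuple]
  | d'.+1 => fun g =>
      (\int[@lebesgue_measure R]_x leb_int (fun t : d'.-tuple R => g (cons_tuple x t)))%E
  end.

Section defs.
Variable R : realType.

Definition unit_cube (d : nat) : set (d.-tuple R) :=
  [set x | forall j : 'I_d, 0 <= tnth x j <= 1].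
Arguments unit_cube : clear implicits.


Definition orthant (d : nat) (u : d.-tuple R) : set (d.-tuple R) :=
  [set x | forall j : 'I_d, tnth x j <= tnth u j].

Definition box0 (d : nat) (u : d.-tuple R) : set (d.-tuple R) :=
  [set x | forall j : 'I_d, 0 <= tnth x j <= tnth u j].

Definition is_copula (d : nat) (C : d.-tuple R -> R) : Prop :=
  exists mu : probability (d.-tuple R) R,
    mu (unit_cube d) = 1%E /\
    (forall (j : 'I_d) (t : R), 0 <= t <= 1 ->
        mu [set x | tnth x j <= t] = t%:E) /\
    (forall u, unit_cube d u -> (C u)%:E = mu (orthant u)).

Definition cdf_has_density (d : nat) (C c : d.-tuple R -> R) : Prop :=
  (forall u, unit_cube d u -> 0 <= c u) /\
  forall u, unit_cube d u ->
    (C u)%:E = leb_int (fun x => ((c x)%:E * (\1_(box0 u) x)%:E)%E).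

Definition has_density (d : nat) (Q : probability (d.-tuple R) R)
    (f : d.-tuple R -> R) : Prop :=
  measurable_fun setT f /\ (forall x, 0 <= f x) /\
  forall A, measurable A ->
    Q A = leb_int (fun x => ((f x)%:E * (\1_A x)%:E)%E).

Definition quantile (G : R -> R) (a : R) : R := inf [set y | a <= G y].

Definition mod_incr (G : R -> R) (delta y : R) : R :=
  Num.min (G (y + delta) - G y) (G y - G (y - delta)).

Definition emp_cdf (n : nat) (ys : 'I_n -> R) (y : R) : R :=
  (\sum_(i < n) (if ys i <= y then 1 else 0)) / n%:R.

Definition norm2 (p : nat) (v : 'rV[R]_p) : R :=
  Num.sqrt (\sum_(j < p) v ord0 j ^+ 2).

Definition tuple2row (d : nat) (x : d.-tuple R) : 'rV[R]_d := \row_j tnth x j.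

Definition mutually_independent {dO dT} {Omega : measurableType dO}
    {T : measurableType dT} (P : probability Omega R) (n : nat)
    (Y : 'I_n -> Omega -> T) : Prop :=
  forall A : 'I_n -> set T, (forall i, measurable (A i)) ->
    P (\big[setI/setT]_(i < n) (Y i @^-1` A i)) =
    (\prod_(i < n) P (Y i @^-1` A i))%E.

End defs.

(* Main.v *)
Require Import Defs.
From HB Require Import structures.
From mathcomp Require Import all_boot all_order all_algebra.
From mathcomp Require Import all_classical all_reals all_analysis.
From mathcomp Require Import measurable_realfun ring lra.
Import Order.TTheory GRing.Theory Num.Theory.
Import numFieldNormedType.Exports.
Local Open Scope classical_set_scope.
Local Open Scope ring_scope.

(** P_theta is the image of the copula measure mu_theta under the componentwise
    quantile transform T of the marginals, which does not depend on theta. Hence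
    |P_theta(A) - P_theta'(A)| = |mu_theta(T^-1 A) - mu_theta'(T^-1 A)| is at most
    sup |c_theta - c_theta'|, and since c is continuous and the cube compact, the
    CDFs G_theta depend continuously on theta in the uniform norm. Together with
    the uniform modulus of increase this makes theta |-> G_theta^-1(alpha)
    continuous on Theta, so that it attains its infimum.

    The event that an empirical quantile is off by more than delta is a deviation
    of a binomial proportion by at least the modulus of increase at delta, which
    has probability at most 2 rho^n with rho < 1 independent of theta (Chernoff).
    As N_n is at most polynomial in n, a union bound makes all empirical quantiles
    over the grid delta-close to the true ones with probability tending to 1; on
    that event both conclusions follow deterministically from the argmin property
    and the density of the grid. *)

(** * Quantiles of distribution functions *)

Section quantile_theory.
Context {R : realType}.
Implicit Types (G : R -> R) (a y : R).

(** The set of [y] with [a <= G y] is a ray that is closed on the left: it is upward closed by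
    monotonicity, and the weak right-continuity hypothesis lets it contain its infimum. The last two
    hypotheses make it nonempty and bounded below, so that [inf] is a genuine infimum. The abstract
    form serves both true and empirical distribution functions. *)
Lemma quantile_le G a y :
  {homo G : x y / x <= y} ->
  (forall x, G x < a -> exists2 e, 0 < e & G (x + e) < a) ->
  (exists x, a <= G x) -> (exists x, G x < a) ->
  (quantile G a <= y) = (a <= G y).
Proof.
move=> ndG rcG [x1 ax1] [x0 ax0].
have lbS : lbound [set y | a <= G y] x0.
  move=> z /= az; rewrite leNgt; apply/negP => zx0.
  by move: (le_lt_trans (le_trans az (ndG _ _ (ltW zx0))) ax0); rewrite ltxx.
apply/idP/idP => [qy|ay]; last by apply: ge_inf => //; exists x0.
rewrite leNgt; apply/negP => /rcG[e e0 aGe].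
suff : y + e <= quantile G a.
  by move=> /le_trans/(_ qy); rewrite gerDl leNgt e0.
apply: lb_le_inf; first by exists x1.
move=> z /= az; rewrite leNgt; apply/negP => ze.
by move: (le_lt_trans (le_trans az (ndG _ _ (ltW ze))) aGe); rewrite ltxx.
Qed.

Context {dT} {T : measurableType dT} (P : probability T R) (X : T -> R).
Hypothesis mX : measurable_fun setT X.
Let G y := fine (P (X @^-1` [set z | z <= y])).

Let X' : {RV P >-> R} := HB.pack X (isMeasurableFun.Build _ _ _ _ X mX).

Lemma rv_cdfE y : (G y)%:E = cdf X' y.
Proof.
have -> : G y = fine (cdf X' y).
  rewrite /G (_ : [set z | z <= y] = `]-oo, y]%classic) //.
by rewrite fineK // fin_num_measure.
Qed.

Lemma rv_cdf_nondecreasing : {homo G : x y / x <= y}.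
Proof. by move=> x y xy; rewrite -lee_fin !rv_cdfE cdf_nondecreasing. Qed.

Lemma rv_cdf_right_lt a x : G x < a -> exists2 e, 0 < e & G (x + e) < a.
Proof.
move=> Gxa; have := @cdf_right_continuous _ _ _ P X' x.
have : nbhs (cdf X' x) [set z | (z < a%:E)%E].
  by apply: open_nbhs_nbhs; split; [exact: open_ereal_lt_ereal|rewrite /= -rv_cdfE lte_fin].
move=> /[swap]/[apply]; rewrite /= near_simpl /=.
move=> [e /= e0 He]; exists (e / 2); first by rewrite divr_gt0.
rewrite -lte_fin rv_cdfE; apply: He => /=.
  rewrite opprD addNKr normrN gtr0_norm ?divr_gt0 //.
  by rewrite gtr_pMr // invf_lt1 // ltr1n.
by rewrite ltrDl divr_gt0.
Qed.

Lemma rv_cdf_ge a : a < 1 -> exists x, a <= G x.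
Proof.
move=> a1; have := @cvg_cdfy1 _ _ _ P X'.
have : nbhs (1 : \bar R)%E [set z | (a%:E < z)%E].
  by apply: open_nbhs_nbhs; split; [exact: open_ereal_gt_ereal|rewrite /= lte_fin].
move=> /[swap]/[apply]; rewrite /= near_simpl => -[M [_ HM]].
by exists (M + 1); rewrite -lee_fin rv_cdfE ltW // HM // ltrDl.
Qed.

Lemma rv_cdf_lt a : 0 < a -> exists x, G x < a.
Proof.
move=> a0; have := @cvg_cdfNy0 _ _ _ P X'.
have : nbhs (0 : \bar R)%E [set z | (z < a%:E)%E].
  by apply: open_nbhs_nbhs; split; [exact: open_ereal_lt_ereal|rewrite /= lte_fin].
move=> /[swap]/[apply]; rewrite /= near_simpl => -[M [_ HM]].
by exists (M - 1); rewrite -lte_fin rv_cdfE HM // ltrBlDr ltrDl.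
Qed.

Lemma quantile_rv_le a y : 0 < a < 1 -> (quantile G a <= y) = (a <= G y).
Proof.
move=> /andP[a0 a1]; apply: quantile_le.
- exact: rv_cdf_nondecreasing.
- exact: rv_cdf_right_lt.
- exact: rv_cdf_ge.
- exact: rv_cdf_lt.
Qed.

(** Were [G] above [a] at its quantile, continuity would keep it above [a] slightly to the left,
    where [quantile_rv_le] forbids it. *)
Lemma cdf_quantile a : 0 < a < 1 -> {for quantile G a, continuous G} ->
  G (quantile G a) = a.
Proof.
move=> a01 cG; apply/eqP; rewrite eq_le -quantile_rv_le // lexx andbT.
rewrite leNgt; apply/negP => aG.
have : \forall y \near quantile G a, a < G y.
  exact: (cvgr_gt (G (quantile G a)) cG).
move=> [e /= e0 He].
have : a < G (quantile G a - e / 2).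
  apply: He => /=; rewrite opprB addrC subrK gtr0_norm ?divr_gt0 //.
  by rewrite gtr_pMr // invf_lt1 // ltr1n.
move=> /ltW; rewrite -quantile_rv_le // leNgt ltrBlDr ltrDl.
by rewrite divr_gt0.
Qed.

End quantile_theory.

(** * Orthants and iterated Lebesgue integrals *)

Section orthants.
Context {R : realType} {d : nat}.
Implicit Types u : d.-tuple R.

Lemma measurable_orthant u : measurable (orthant u).
Proof.
rewrite (_ : orthant u = \bigcap_(j in [set: 'I_d]) ((@tnth _ R ^~ j) @^-1` `]-oo, tnth u j])).
  apply: fin_bigcap_measurable => // j _.
  by rewrite -[X in measurable X]setTI; apply: measurable_tnth.
apply/seteqP; split => x /= H j; first by move=> _; rewrite /= in_itv /= H.
by have := H j I; rewrite /= in_itv.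
Qed.

Lemma measurable_unit_cube : measurable (@unit_cube R d).
Proof.
rewrite (_ : @unit_cube R d = \bigcap_(j in [set: 'I_d]) ((@tnth _ R ^~ j) @^-1` `[0, 1])).
  apply: fin_bigcap_measurable => // j _.
  by rewrite -[X in measurable X]setTI; apply: measurable_tnth.
apply/seteqP; split => x /= H j; first by move=> _; rewrite /= in_itv /= H.
by have := H j I; rewrite /= in_itv.
Qed.

(** The half-space is the union over [n] of the orthants whose other corner coordinates equal [n].
    Leaving [D] general covers both the sigma-algebra generated by orthants and the product one. *)
Lemma measurable_coord_halfspace (D : set (set (d.-tuple R))) (j : 'I_d) (a : R) :
  sigma_algebra setT D -> (forall u, D (orthant u)) ->
  D [set x | tnth x j <= a].
Proof.
move=> [_ _ Dcup] Do.
rewrite (_ : [set x | _] = \bigcup_n orthant [tuple if i == j then a else n%:R | i < d]).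
  exact: Dcup.
apply/seteqP; split => x /=.
  move=> xa; pose M := \big[Num.max/0]_(i < d) tnth x i.
  exists (Num.truncn M).+1 => // i; rewrite tnth_mktuple; case: eqP => [->//|_].
  by apply: (@le_trans _ _ M); [exact: le_bigmax | rewrite ltW // truncnS_gt].
by move=> [n _ /(_ j)]; rewrite tnth_mktuple eqxx.
Qed.

(** The identity map out of the orthant-generated sigma-algebra is measurable because each of its
    coordinates is. *)
Lemma measurable_tuple_orthant A : measurable A ->
  <<s [set orthant u | u in [set: d.-tuple R]] >> A.
Proof.
move=> mA; set G := [set _ | _ in _].
suff H : forall j, measurable_fun (setT : set (g_sigma_algebraType G))
    (fun x : g_sigma_algebraType G => tnth x j).
  have : measurable_fun (setT : set (g_sigma_algebraType G))
      (fun x : g_sigma_algebraType G => (x : d.-tuple R)).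
    by apply/measurable_fun_tnthP => j; exact: H.
  by move=> /(_ measurableT _ mA); rewrite setTI preimage_id.
move=> j; apply: (measurability _ (RGenOInfty.measurableE R)) => B [C [a ->] <-].
rewrite setTI (_ : _ @^-1` _ = ~` [set x | tnth x j <= a]).
  apply: (@measurableC _ (g_sigma_algebraType G)); apply: measurable_coord_halfspace.
    exact: smallest_sigma_algebra.
  by move=> u; apply: sub_sigma_algebra; exists u.
by apply/seteqP; split => x /=; rewrite in_itv /= andbT ltNge => /negP.
Qed.

(** Orthants form a pi-system, intersections being given by the coordinatewise minimum of the
    corners, and those with corner (n,...,n) exhaust the space. *)
Lemma orthant_measure_unique (m1 m2 : {measure set (d.-tuple R) -> \bar R}) :
  (forall u, m1 (orthant u) = m2 (orthant u)) ->
  (forall u, (m1 (orthant u) < +oo)%E) ->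
  forall A, measurable A -> m1 A = m2 A.
Proof.
move=> m12 m1oo A /measurable_tuple_orthant.
apply: (g_sigma_algebra_measure_unique [set orthant u | u in [set: d.-tuple R]]
  _ (fun n => orthant [tuple n%:R | i < d])) => //.
- by move=> _ [u _ <-]; exact: measurable_orthant.
- rewrite -subTset => x _ /=; pose M := \big[Num.max/0]_(i < d) tnth x i.
  exists (Num.truncn M).+1 => // i; rewrite tnth_mktuple.
  by apply: (@le_trans _ _ M); [exact: le_bigmax | rewrite ltW // truncnS_gt].
- move=> _ _ [u _ <-] [v _ <-].
  exists [tuple Num.min (tnth u i) (tnth v i) | i < d] => //.
  apply/seteqP; split => x /=.
    by move=> H; split => i; have := H i; rewrite tnth_mktuple le_min => /andP[].
  by move=> [H1 H2] i; rewrite tnth_mktuple le_min H1 H2.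
- by move=> _ [u _ <-].
Qed.

End orthants.

(** * Tonelli-type rules for the iterated Lebesgue integral *)

Section leb_int_theory.
Context {R : realType}.
Local Open Scope ereal_scope.

Lemma leb_int_ge0 {d} (g : d.-tuple R -> \bar R) :
  (forall t, 0 <= g t) -> 0 <= leb_int g.
Proof.
elim: d g => [|d IH] g g0 /=; first exact: g0.
by apply: integral_ge0 => x _; apply: IH.
Qed.

(** The parameter space is arbitrary so that the induction can absorb the outermost integration
    variable into it, passing from [T] to [T * R]. *)
Lemma measurable_leb_int {d dT} {T : measurableType dT} (g : T * d.-tuple R -> \bar R) :
  measurable_fun (setT : set (T * d.-tuple R)) g -> (forall z, 0 <= g z) ->
  measurable_fun setT (fun z => leb_int (fun t => g (z, t))).
Proof.
elim: d dT T g => [|d IH] dT T g mg g0 /=.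
  by apply: (measurableT_comp mg); exact: measurable_fun_pair.
pose h (y : (T * R) * d.-tuple R) := g (y.1.1, cons_tuple y.1.2 y.2).
have mh : measurable_fun (setT : set ((T * R) * d.-tuple R)) h.
  apply: (measurableT_comp mg); apply: measurable_fun_pair => /=.
    exact: measurableT_comp.
  by apply: measurable_cons => //; exact: measurableT_comp.
have := @measurable_fun_fubini_tonelli_F _ _ _ _ _ (@lebesgue_measure R)
  (fun z : T * R => leb_int (fun t => h (z, t))).
apply; first by apply: IH => // z; exact: g0.
by move=> z; apply: leb_int_ge0 => t; exact: g0.
Qed.

Lemma measurable_cons_section {d} (g : d.+1.-tuple R -> \bar R) (x : R) :
  measurable_fun setT g -> measurable_fun setT (fun t : d.-tuple R => g (cons_tuple x t)).
Proof. by move=> mg; apply: (measurableT_comp mg); exact: measurable_cons. Qed.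

Lemma measurable_leb_int_cons {d} (g : d.+1.-tuple R -> \bar R) :
  measurable_fun setT g -> (forall t, 0 <= g t) ->
  measurable_fun setT (fun x : R => leb_int (fun t => g (cons_tuple x t))).
Proof.
move=> mg g0; apply: (measurable_leb_int (fun z => g (cons_tuple z.1 z.2))) => //.
by apply: (measurableT_comp mg); exact: measurable_cons.
Qed.

Lemma le_leb_int {d} (g h : d.-tuple R -> \bar R) :
  measurable_fun setT g -> measurable_fun setT h ->
  (forall t, 0 <= g t) -> (forall t, g t <= h t) -> leb_int g <= leb_int h.
Proof.
elim: d g h => [|d IH] g h mg mh g0 gh /=; first exact: gh.
have h0 t : 0 <= h t by exact: le_trans (gh t).
apply: ge0_le_integral => //.
- by move=> x _; exact: leb_int_ge0.
- exact: measurable_leb_int_cons.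
- exact: measurable_leb_int_cons.
- by move=> x _; apply: IH => //; exact: measurable_cons_section.
Qed.

Lemma leb_intD {d} (g h : d.-tuple R -> \bar R) :
  measurable_fun setT g -> measurable_fun setT h ->
  (forall t, 0 <= g t) -> (forall t, 0 <= h t) ->
  leb_int (fun t => g t + h t) = leb_int g + leb_int h.
Proof.
elim: d g h => [//|d IH] g h mg mh g0 h0 /=.
rewrite -ge0_integralD //; first last.
- exact: measurable_leb_int_cons.
- by move=> x _; exact: leb_int_ge0.
- exact: measurable_leb_int_cons.
- by move=> x _; exact: leb_int_ge0.
by apply: eq_integral => x _; apply: IH => //; exact: measurable_cons_section.
Qed.

Lemma leb_intZl {d} (k : R) (g : d.-tuple R -> \bar R) : (0 <= k)%R ->
  measurable_fun setT g -> (forall t, 0 <= g t) ->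
  leb_int (fun t => k%:E * g t) = k%:E * leb_int g.
Proof.
move=> k0; elim: d g => [//|d IH] g mg g0 /=.
rewrite -ge0_integralZl_EFin //; first last.
- exact: measurable_leb_int_cons.
- by move=> x _; exact: leb_int_ge0.
by apply: eq_integral => x _; apply: IH => //; exact: measurable_cons_section.
Qed.

Lemma leb_int_nneseries {d} (g : nat -> d.-tuple R -> \bar R) :
  (forall n, measurable_fun setT (g n)) -> (forall n t, 0 <= g n t) ->
  leb_int (fun t => \sum_(n <oo) g n t) = \sum_(n <oo) leb_int (g n).
Proof.
elim: d g => [//|d IH] g mg g0 /=.
rewrite -integral_nneseries //; first last.
- by move=> n x _; exact: leb_int_ge0.
- by move=> n; exact: measurable_leb_int_cons.
by apply: eq_integral => x _; apply: IH => // n; exact: measurable_cons_section.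
Qed.

Lemma leb_int0 {d} : leb_int (fun _ : d.-tuple R => 0) = 0.
Proof. by elim: d => [//|d IH] /=; rewrite IH integral0. Qed.

Lemma leb_int_cube {d} : leb_int (fun t => (\1_(@unit_cube R d) t)%:E) = 1.
Proof.
elim: d => [|d IH] /=.
  by rewrite indicE mem_set // => -[].
rewrite (_ : (fun x => _) = (fun x : R => (\1_`[0%R, 1%R] x)%:E)).
  rewrite integral_indic // setIT; apply: etrans (lebesgue_measure_itv _) _.
  by rewrite /= lte_fin ltr01 oppr0 adde0.
apply/funext => x.
rewrite (_ : (fun t => _) = (fun t => (\1_`[0%R, 1%R] x)%:E * (\1_(@unit_cube R d) t)%:E)).
  rewrite leb_intZl // ?IH ?mule1 //; apply/measurable_EFinP.
  by apply: measurable_indic; exact: measurable_unit_cube.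
apply/funext => t; rewrite -EFinM !indicE -natrM mulnb; congr (_%:R%:E).
congr nat_of_bool; apply/idP/andP; rewrite !inE /=.
  move=> H; split; first by have := H ord0; rewrite in_itv.
  by move=> j; have := H (lift ord0 j); rewrite tnthS.
by rewrite in_itv /= => -[x01 H] j; case: (unliftP ord0 j) => [k ->|->] //; rewrite tnthS.
Qed.

End leb_int_theory.

(** * Copula measures and their densities *)

Lemma probability_setI1 {R : realType} {dT} {T : measurableType dT} (P : probability T R)
    (A N : set T) :
  measurable A -> measurable N -> P N = 1%E -> P (A `&` N) = P A.
Proof.
move=> mA mN PN; rewrite [RHS](measureDI P mA mN).
rewrite [X in (X + _)%E](_ : _ = 0%E) ?add0e //.
apply: (@subset_measure0 _ _ _ P _ (~` N)).
- exact: measurableD mA mN.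
- exact: measurableC.
- by move=> x [].
- by apply: etrans (probability_setC P mN) _; rewrite PN subee.
Qed.

Section copula_densities.
Context {R : realType} {d : nat}.
Implicit Types (g : d.-tuple R -> R) (mu : probability (d.-tuple R) R).

(** An open set of row vectors is a countable union of boxes with rational centres and radii
    1/(n+1), and each box is measurable for the product sigma-algebra. *)
Lemma measurable_tuple2row_open (O : set 'rV[R]_d) : open O ->
  measurable (@tuple2row R d @^-1` O).
Proof.
move=> oO.
pose box (q : d.-tuple rat * nat) : set (d.-tuple R) :=
  [set t | forall j, `|ratr (tnth q.1 j) - tnth t j| < q.2.+1%:R^-1].
have mbox q : measurable (box q).
  rewrite (_ : box q = \bigcap_(j in [set: 'I_d])
    ((@tnth _ R ^~ j) @^-1` (ball (ratr (tnth q.1 j) : R) q.2.+1%:R^-1))).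
    apply: fin_bigcap_measurable => // j _.
    by rewrite -[X in measurable X]setTI; apply: measurable_tnth => //; exact: measurable_ball.
  by apply/seteqP; split => x /= H j; [move=> _; exact: H|exact: (H j I)].
rewrite (_ : _ @^-1` _ = \bigcup_(q in [set q | box q `<=` @tuple2row R d @^-1` O]) box q).
  rewrite bigcup_mkcond; apply: countable_bigcupT_measurable => // q.
  by case: ifP.
apply/seteqP; split => t /=; last by move=> [q]; apply.
move=> tO; have /nbhs_ballP[e /= e0 eO] : nbhs (tuple2row t) O by exact: open_nbhs_nbhs.
(* Half of [e], since points of the box are compared with [t] through its rational centre. *)
have [n ne] : exists n : nat, n.+1%:R^-1 < e / 2 :> R.
  have e20 : 0 < e / 2 by rewrite divr_gt0.
  exists (Num.truncn (e / 2)^-1); rewrite invf_plt ?posrE //.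
  exact: truncnS_gt.
have n0 : 0 < n.+1%:R^-1 :> R by rewrite invr_gt0.
have /choice[q qP] : forall j : 'I_d, exists r : rat, `|ratr r - tnth t j| < n.+1%:R^-1 :> R.
  move=> j; have : tnth t j - n.+1%:R^-1 < tnth t j + n.+1%:R^-1.
    by rewrite ltrD2l gtrN.
  move=> /rat_in_itvoo[r]; rewrite in_itv /= => rj.
  by exists r; rewrite ltr_distl.
exists ([tuple q j | j < d], n); last by move=> j /=; rewrite tnth_mktuple.
move=> s /= sq; apply: eO; split => // i j.
rewrite !ord1 /ball /= !mxE.
have := sq j; have := qP j; rewrite tnth_mktuple distrC => h1 h2.
rewrite -(subrKA (ratr (q j))) (le_lt_trans (ler_normD _ _)) //.
by rewrite [e]splitr ltrD // (lt_trans _ ne).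
Qed.


(** The unit cube again, carried over to row vectors, where continuity and compactness are
    available. *)
Definition row_cube : set 'rV[R]_d := [set u | forall j, 0 <= u ord0 j <= 1].

Lemma row_cubeE t : row_cube (tuple2row t) = unit_cube t.
Proof.
by apply/propext; split => H j; have := H j; rewrite mxE.
Qed.

Lemma measurable_fun_cube (h : 'rV[R]_d -> R) : {within row_cube, continuous h} ->
  measurable_fun (@unit_cube R d) (fun t => h (tuple2row t)).
Proof.
move=> ch mD; apply: (measurability _ (RGenOpens.measurableE R)) => // B [_ [a [b ->]] <-].
have /open_subspaceP[V oV VE] : open ((h : subspace row_cube -> R) @^-1` `]a, b[).
  by apply: open_comp; [move=> x _; exact: ch|exact: interval_open].
rewrite (_ : _ `&` _ = @unit_cube R d `&` @tuple2row R d @^-1` V).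
  by apply: measurableI; [exact: measurable_unit_cube|exact: measurable_tuple2row_open].
apply/seteqP; split => t /= [ct hV]; split => //.
  have : (h @^-1` `]a, b[ `&` row_cube) (tuple2row t) by split; rewrite ?row_cubeE.
  by rewrite -VE => -[].
have : (V `&` row_cube) (tuple2row t) by split; rewrite ?row_cubeE.
by rewrite VE => -[].
Qed.

Section density_measure.
Variable g : d.-tuple R -> R.
Hypothesis mg : measurable_fun setT g.
Hypothesis g0 : forall t, 0 <= g t.
Local Open Scope ereal_scope.

(* The proofs are arguments, for density_mass to be declared a measure. *)
Definition density_mass of measurable_fun setT g & (forall t, (0 <= g t)%R) :=
  fun A : set (d.-tuple R) => leb_int (fun t => (g t)%:E * (\1_A t)%:E).

Local Notation nu := (density_mass mg g0).

Let measurable_dens A : measurable A -> measurable_fun setT (fun t => (g t)%:E * (\1_A t)%:E).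
Proof.
move=> mA; under eq_fun do rewrite -EFinM.
by apply/measurable_EFinP; apply: measurable_funM => //; exact: measurable_indic.
Qed.

Let dens_ge0 A t : 0 <= (g t)%:E * (\1_A t)%:E.
Proof. by rewrite mule_ge0 // lee_fin. Qed.

Let nu0 : nu set0 = 0.
Proof.
rewrite /density_mass (_ : (fun _ => _) = fun=> 0) ?leb_int0 //.
by apply/funext => t; rewrite indic0 mule0.
Qed.

Let nu_ge0 A : 0 <= nu A.
Proof. exact: leb_int_ge0. Qed.

Let nu_sigma_additive : semi_sigma_additive nu.
Proof.
move=> F mF tF mUF; rewrite /density_mass.
rewrite [X in _ --> X](_ : _ = \sum_(n <oo) nu (F n)).
  exact: (@is_cvg_ereal_nneg_natsum R (fun n => nu (F n)) 0%N (fun n _ => nu_ge0 _)).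
rewrite -leb_int_nneseries //; last by move=> n; exact: measurable_dens.
congr leb_int; apply/funext => t.
rewrite nneseriesZl //.
(* The series of indicators at [t] is countable additivity of the Dirac mass at [t]. *)
congr (_ * _); have := @measure_semi_bigcup _ _ _ (\d_t : {measure set _ -> \bar R}) F mF tF mUF.
by rewrite /= /dirac.
Qed.

HB.instance Definition _ := isMeasure.Build _ _ _ nu nu0 nu_ge0 nu_sigma_additive.

(** Both measures live on the cube, so agreement on orthants with corner in the cube extends to all
    orthants: a negative corner coordinate gives mass zero on both sides, and coordinates above 1
    may be truncated to 1. *)
Lemma density_mass_unique mu :
  mu (@unit_cube R d) = 1 ->
  (forall t, ~ unit_cube t -> g t = 0%R) ->
  (forall u, unit_cube u ->
     mu (orthant u) = leb_int (fun t => (g t)%:E * (\1_(box0 u) t)%:E)) ->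
  forall A, measurable A -> mu A = leb_int (fun t => (g t)%:E * (\1_A t)%:E).
Proof.
move=> mu1 gout mug A mA; rewrite -/(nu A).
apply: orthant_measure_unique => // u; last first.
  by rewrite (le_lt_trans (probability_le1 _ _)) ?ltry //; exact: measurable_orthant.
have mucapE B : measurable B -> mu (B `&` @unit_cube R d) = mu B.
  by move=> mB; apply: probability_setI1 => //; exact: measurable_unit_cube.
transitivity (mu (orthant u `&` @unit_cube R d)).
  by apply/esym/mucapE; exact: measurable_orthant.
have [[j uj0]|/forallNP u0] := pselect (exists j, (tnth u j < 0)%R).
  have disj t : unit_cube t -> ~ orthant u t.
    by move=> /(_ j)/andP[t0 _] /(_ j) /(le_trans t0); rewrite leNgt uj0.
  rewrite (_ : orthant u `&` _ = set0) ?measure0; last first.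
    by rewrite -subset0 => t [/[swap] /disj].
  rewrite /= /density_mass [X in leb_int X](_ : _ = fun=> 0) ?leb_int0 //.
  apply/funext => t; have [/disj ut|/gout ->] := pselect (unit_cube t); last by rewrite mul0e.
  by rewrite indicE memNset ?mule0.
pose v := [tuple Num.min (tnth u j) 1%R | j < d].
have cv : unit_cube v.
  move=> j; rewrite tnth_mktuple ge_min lexx orbT andbT le_min ler01 andbT.
  by rewrite leNgt; apply/negP; exact: u0.
have ov t : unit_cube t -> orthant u t <-> orthant v t.
  move=> ct; split=> H j; have := H j; rewrite tnth_mktuple le_min.
    by move=> ->; have /andP[] := ct j.
  by move=> /andP[].
rewrite (_ : orthant u `&` _ = orthant v `&` @unit_cube R d); last first.
  by apply/seteqP; split => t [ht ct]; split => //; apply/(ov t ct).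
rewrite mucapE; last exact: measurable_orthant.
rewrite mug //; congr leb_int; apply/funext => t.
have [ct|/gout ->] := pselect (unit_cube t); last by rewrite !mul0e.
congr (_ * (_%:E)); rewrite !indicE; congr (_%:R); congr nat_of_bool.
apply/idP/idP; rewrite !inE /= => ht; first by apply/(ov t ct) => j; have /andP[] := ht j.
by move=> j; have /andP[-> _] := ct j; exact: ((ov t ct).1 ht j).
Qed.

End density_measure.

End copula_densities.

Section copula_models.
Context {R : realType} {d : nat}.
Implicit Types (h : 'rV[R]_d -> R) (P mu : probability (d.-tuple R) R).

(** The density is controlled only on the cube, so it is extended by zero to become measurable and
    nonnegative everywhere. *)
Lemma copula_measureE mu h :
  mu (@unit_cube R d) = 1%E -> {within row_cube, continuous h} ->
  (forall u, unit_cube u -> 0 <= h (tuple2row u)) ->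
  (forall u, unit_cube u ->
    mu (orthant u) = leb_int (fun x => ((h (tuple2row x))%:E * (\1_(box0 u) x)%:E)%E)) ->
  forall A, measurable A -> mu A =
    leb_int (fun x => ((((fun t => h (tuple2row t)) \_ (@unit_cube R d)) x)%:E * (\1_A x)%:E)%E).
Proof.
move=> mu1 ch h0 muh.
have mg : measurable_fun setT ((fun t => h (tuple2row t)) \_ (@unit_cube R d)).
  by apply/(measurable_restrictT _ measurable_unit_cube); exact: measurable_fun_cube.
have g0 t : 0 <= ((fun t => h (tuple2row t)) \_ (@unit_cube R d)) t.
  by rewrite patchE; case: ifPn => // /set_mem; exact: h0.
apply: (density_mass_unique _ mg g0) => //.
- by move=> t ct; rewrite patchE memNset.
- move=> u cu; rewrite muh //; congr leb_int; apply/funext => t; rewrite patchE.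
  case: ifPn => [//|/negP ct]; rewrite indicE memNset ?mule0 // => ut.
  apply: ct; apply/mem_set => j; have /andP[-> /=] := ut j.
  by move=> /le_trans; apply; have /andP[] := cu j.
Qed.

(** Integrate [h <= h' + e] over the part of [A] inside the cube, whose Lebesgue measure is at most
    1. The one-sided additive form keeps every integrand nonnegative. *)
Lemma copula_measure_le mu mu' h h' (e : R) :
  mu (@unit_cube R d) = 1%E -> {within row_cube, continuous h} ->
  (forall u, unit_cube u -> 0 <= h (tuple2row u)) ->
  (forall u, unit_cube u ->
    mu (orthant u) = leb_int (fun x => ((h (tuple2row x))%:E * (\1_(box0 u) x)%:E)%E)) ->
  mu' (@unit_cube R d) = 1%E -> {within row_cube, continuous h'} ->
  (forall u, unit_cube u -> 0 <= h' (tuple2row u)) ->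
  (forall u, unit_cube u ->
    mu' (orthant u) = leb_int (fun x => ((h' (tuple2row x))%:E * (\1_(box0 u) x)%:E)%E)) ->
  0 <= e -> (forall u, row_cube u -> h u <= h' u + e) ->
  forall A, measurable A -> (mu A <= mu' A + e%:E)%E.
Proof.
move=> mu1 ch h0 muh mu'1 ch' h'0 mu'h e0 hh' A mA.
rewrite (copula_measureE _ h mu1) // (copula_measureE _ h' mu'1) //.
have mind (B : set (d.-tuple R)) : measurable B ->
    measurable_fun setT (fun t => (\1_B t)%:E : \bar R).
  by move=> mB; apply/measurable_EFinP; exact: measurable_indic.
have mcube : measurable (@unit_cube R d) by exact: measurable_unit_cube.
have mdens (k : 'rV[R]_d -> R) : {within row_cube, continuous k} -> measurable_fun setT
    (fun t => ((((fun t => k (tuple2row t)) \_ (@unit_cube R d)) t)%:E * (\1_A t)%:E : \bar R)%E).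
  move=> ck; apply: emeasurable_funM; last exact: mind.
  by apply/measurable_EFinP/(measurable_restrictT _ mcube); exact: measurable_fun_cube.
have dens0 (k : 'rV[R]_d -> R) t : (forall u, unit_cube u -> 0 <= k (tuple2row u)) ->
    (0 <= (((fun t => k (tuple2row t)) \_ (@unit_cube R d)) t)%:E * (\1_A t)%:E :> \bar R)%E.
  move=> k0; rewrite mule_ge0 // lee_fin // patchE.
  by case: ifPn => // /set_mem; exact: k0.
have me : measurable_fun setT (fun t : d.-tuple R => (e%:E * (\1_(@unit_cube R d) t)%:E)%E).
  by apply: emeasurable_funM => //; exact: mind.
have -> : e%:E = leb_int (fun t : d.-tuple R => e%:E * (\1_(@unit_cube R d) t)%:E)%E.
  by rewrite leb_intZl ?leb_int_cube ?mule1 //; exact: mind.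
rewrite -leb_intD; [|exact: mdens|exact: me|by move=> t; exact: dens0|]; last first.
  by move=> t; rewrite mule_ge0 // lee_fin.
apply: le_leb_int; [exact: mdens| |by move=> t; exact: dens0|].
  by apply: emeasurable_funD => //; exact: mdens.
move=> t; rewrite !patchE !indicE; have [tc|tc] := pselect (unit_cube t).
  rewrite !(mem_set tc) mule1; case: (t \in A); last by rewrite !mule0 add0e lee_fin.
  by rewrite !mule1 -EFinD lee_fin hh' // row_cubeE.
by rewrite !(memNset tc) !mul0e mule0 adde0.
Qed.

(** * The quantile transform of the marginals *)

Section quantile_transform.
Variable Pm : 'I_d -> probability R R.

Let F j y := fine (Pm j [set z | z <= y]).

(** Generalised inverses are used only on (0,1), where they are genuine infima; elsewhere the value
    0 is a convention on a set that is null for uniform marginals. *)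
Definition quantile_transform (u : d.-tuple R) : d.-tuple R :=
  [tuple (quantile (F j) \_ `]0, 1[) (tnth u j) | j < d].

Let quantile_F j a y : 0 < a < 1 -> (quantile (F j) a <= y) = (a <= F j y).
Proof. exact: (quantile_rv_le (Pm j) (fun z => z) (@measurable_id _ _ setT)). Qed.

Lemma measurable_quantile_transform : measurable_fun setT quantile_transform.
Proof.
apply/measurable_fun_tnthP => j.
rewrite (_ : _ \o _ = (quantile (F j) \_ `]0, 1[) \o (@tnth _ R ^~ j)).
  apply: measurableT_comp; last exact: measurable_tnth.
  apply/(measurable_restrictT _ (measurable_itv _)) => mD.
  apply: (measurability _ (RGenOInfty.measurableE R)) => // B [_ [a ->] <-].
  rewrite (_ : _ `&` _ = `]0, 1[ `&` `]F j a, +oo[); first exact: measurableI.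
  apply/seteqP; split => x /= []; rewrite !in_itv /= !andbT => x01.
    by move=> aq; split => //; move: aq; rewrite !ltNge quantile_F.
  by move=> Fx; split => //; move: Fx; rewrite !ltNge quantile_F.
by apply/funext => u /=; rewrite tnth_mktuple.
Qed.

(** On the open cube, the transform of [u] lies in the orthant of [x] exactly when each coordinate
    of [u] is at most [F j (tnth x j)]. The open cube has full mass, so both laws agree on orthants,
    hence everywhere. *)
Lemma quantile_transform_law P mu :
  (forall (j : 'I_d) (t : R), 0 <= t <= 1 -> mu [set x | tnth x j <= t] = t%:E) ->
  (forall x, P (orthant x) = mu (orthant [tuple F j (tnth x j) | j < d])) ->
  forall A, measurable A -> P A = mu (quantile_transform @^-1` A).
Proof.
move=> mu_unif PF A mA.
have mT := measurable_quantile_transform.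
have mhalf j t : measurable [set x : d.-tuple R | tnth x j <= t].
  by apply: measurable_coord_halfspace; [exact: sigma_algebra_measurable|exact: measurable_orthant].
pose N : set (d.-tuple R) := [set x | forall j, 0 < tnth x j < 1].
have mNj j : measurable [set x : d.-tuple R | 0 < tnth x j < 1].
  rewrite (_ : [set x | _] = (@tnth _ R ^~ j) @^-1` `]0, 1[).
    by rewrite -[X in measurable X]setTI; exact: measurable_tnth.
  by apply/seteqP; split => x /=; rewrite in_itv.
have mN : measurable N.
  rewrite (_ : N = \bigcap_(j in [set: 'I_d]) [set x | 0 < tnth x j < 1]).
    exact: fin_bigcap_measurable.
  by apply/seteqP; split => x /= H j; [move=> _; exact: H|exact: (H j I)].
have muNj j : mu (~` [set x | 0 < tnth x j < 1]) = 0%E.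
  apply/eqP; rewrite -measure_le0; apply/lee_addgt0Pr => e e0; rewrite add0e.
  (* The cap at 1 keeps [1 - e'] in [0,1], where uniformity of the marginal applies; the mass
     outside (0,1) is then at most 0 + [e']. *)
  pose e' := Num.min e 1.
  have e'0 : 0 < e' by rewrite lt_min e0 ltr01.
  have e'1 : e' <= 1 by rewrite ge_min lexx orbT.
  apply: (@le_trans _ _ (mu ([set x | tnth x j <= 0] `|` ~` [set x | tnth x j <= 1 - e']))).
    apply: le_measure; rewrite ?inE; [exact: measurableC| |].
      by apply: measurableU => //; exact: measurableC.
    move=> x /= /negP; rewrite negb_and -!leNgt => /orP[|x1]; first by left.
    by right => /(le_trans x1); rewrite leNgt gtrBl e'0.
  apply: (le_trans (measureU2 _ _ _)) => //; first exact: measurableC.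
  have mu0 : mu [set x | tnth x j <= 0] = 0%E by rewrite mu_unif ?lexx ?ler01.
  have mu1 : mu (~` [set x | tnth x j <= 1 - e']) = e'%:E.
    rewrite probability_setC // mu_unif; last by rewrite subr_ge0 e'1 gerBl ltW.
    by rewrite -EFinB subKr.
  rewrite [leLHS](_ : _ = e'%:E) ?lee_fin ?ge_min ?lexx //.
  by rewrite -[RHS]add0e; congr (_ + _)%E.
have muN : mu N = 1%E.
  have aeN j : {ae mu, forall x, 0 < tnth x j < 1}.
    apply/negligibleP; last exact: muNj.
    exact: measurableC (mNj j).
  have : mu (~` N) = 0%E.
    apply/negligibleP; first exact: measurableC.
    exact: (@filter_forall _ _ (fun j => [set x | 0 < tnth x j < 1]) (almost_everywhere mu) _ aeN).
  by rewrite probability_setC // => /eqP; rewrite sube_eq ?add0e // => /eqP <-.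
pose T' : {mfun d.-tuple R >-> d.-tuple R} :=
  HB.pack quantile_transform (isMeasurableFun.Build _ _ _ _ quantile_transform mT).
transitivity (pushforward mu T' A); last by [].
apply: (orthant_measure_unique P (pushforward mu T')) => // u; last first.
  by rewrite (le_lt_trans (probability_le1 _ _)) ?ltry //; exact: measurable_orthant.
transitivity (mu (orthant [tuple F j (tnth u j) | j < d] `&` N)).
  by rewrite probability_setI1 //; [exact: PF|exact: measurable_orthant].
transitivity (mu (quantile_transform @^-1` orthant u `&` N)); last first.
  rewrite probability_setI1 //.
  rewrite -[X in measurable X]setTI; apply: measurable_quantile_transform => //.
  exact: measurable_orthant.
congr (mu _); apply/seteqP; split => x /= [Hx Nx]; split => // j;
  have := Hx j; rewrite !tnth_mktuple patchE mem_set ?quantile_F //;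
  by rewrite /= in_itv /=; exact: Nx.
Qed.

End quantile_transform.

End copula_models.

(** * Dependence of the model on the copula parameter *)

Section copula_family.
Context {R : realType} {d p : nat}.

(** Joint continuity gives a product neighbourhood around each [(th, u)]; compactness of the cube
    makes the neighbourhood of [th] uniform in [u]. *)
Lemma copula_density_near (Theta : set 'rV[R]_p) (c : 'rV[R]_p -> 'rV[R]_d -> R) th :
  {within Theta `*` row_cube, continuous (fun z : 'rV[R]_p * 'rV[R]_d => c z.1 z.2)} ->
  Theta th -> forall e, 0 < e ->
  \forall th' \near within Theta (nbhs th), forall u, row_cube u -> `|c th u - c th' u| < e.
Proof.
move=> /subspace_continuousP cc Tth e e0.
have Kc : compact (@row_cube R d).
  rewrite (_ : row_cube = [set u : 'rV[R]_d | forall j, `[0, 1]%classic (u ord0 j)]).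
    exact: (@rV_compact R d (fun=> `[0, 1]%classic) (fun=> segment_compact (a := 0) (b := 1))).
  by apply/seteqP; split => u /= H j; have := H j; rewrite in_itv.
have /near_covering_withinP Kn := (compact_near_coveringP _).1 Kc.
apply: (Kn _ (within Theta (nbhs th)) (fun th' u => `|c th u - c th' u| < e)) => u Ku.
have e20 : 0 < e / 2 by rewrite divr_gt0.
have /cvgrPdist_lt /(_ _ e20) [[B C] /= [Bth Cu] BC] := cc (th, u) (conj Tth Ku).
exists (C, [set th' | B th' /\ Theta th']) => /=.
  by split => //; apply: filterS Bth => th' Bth' Tth'; split.
move=> [u' th'] /= [Cu' [Bth' Tth']] Ku'.
have h1 := BC (th, u') (conj (nbhs_singleton Bth) Cu') (conj Tth Ku').
have h2 := BC (th', u') (conj Bth' Cu') (conj Tth' Ku').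
rewrite -(subrKA (c th u)) (le_lt_trans (ler_normD _ _)) // [e]splitr ltrD //.
by rewrite distrC.
Qed.

Lemma copula_density_section (Theta : set 'rV[R]_p) (c : 'rV[R]_p -> 'rV[R]_d -> R) th :
  {within Theta `*` row_cube, continuous (fun z : 'rV[R]_p * 'rV[R]_d => c z.1 z.2)} ->
  Theta th -> {within row_cube, continuous (c th)}.
Proof.
move=> /subspace_continuousP cc Tth; apply/subspace_continuousP => u Ku.
apply/cvgrPdist_lt => e e0.
have /cvgrPdist_lt /(_ _ e0) [[B C] /= [Bth Cu] BC] := cc (th, u) (conj Tth Ku).
apply: filterS Cu => u' Cu' Ku'.
exact: (BC (th, u') (conj (nbhs_singleton Bth) Cu') (conj Tth Ku')).
Qed.

(** Both models share their marginals, hence the quantile transform, so the comparison reduces to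
    the two copula measures on one and the same preimage of [A]. *)
Lemma copula_model_le (Pm : 'I_d -> probability R R) (C C' : d.-tuple R -> R)
    (h h' : 'rV[R]_d -> R) (P P' : probability (d.-tuple R) R) (e : R) :
  is_copula C -> is_copula C' ->
  cdf_has_density C (fun u => h (tuple2row u)) ->
  cdf_has_density C' (fun u => h' (tuple2row u)) ->
  {within row_cube, continuous h} -> {within row_cube, continuous h'} ->
  (forall x, P (orthant x) = (C [tuple fine (Pm j [set y | y <= tnth x j]) | j < d])%:E) ->
  (forall x, P' (orthant x) = (C' [tuple fine (Pm j [set y | y <= tnth x j]) | j < d])%:E) ->
  0 <= e -> (forall u, row_cube u -> h u <= h' u + e) ->
  forall A, measurable A -> (P A <= P' A + e%:E)%E.
Proof.
move=> [mu [mu1 [muU muC]]] [mu' [mu'1 [mu'U mu'C]]] [h0 hC] [h'0 h'C] ch ch' PC P'C e0 hh' A mA.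
have cF x : unit_cube [tuple fine (Pm j [set y | y <= tnth x j]) | j < d].
  move=> j; rewrite tnth_mktuple fine_ge0 //=.
  have mS : measurable [set y | y <= tnth x j].
    rewrite (_ : [set y | _] = `]-oo, tnth x j]%classic) //.
  by rewrite -lee_fin fineK ?probability_le1 // fin_num_measure.
rewrite (quantile_transform_law Pm P mu muU _ A mA); last first.
  by move=> x; rewrite PC muC.
rewrite (quantile_transform_law Pm P' mu' mu'U _ A mA); last first.
  by move=> x; rewrite P'C mu'C.
apply: (copula_measure_le mu mu' h h') => //.
- by move=> u cu; rewrite -muC // hC.
- by move=> u cu; rewrite -mu'C // h'C.
by rewrite -[X in measurable X]setTI; exact: measurable_quantile_transform.
Qed.

End copula_family.

(** * Concentration of empirical quantiles *)

Section tail_bounds.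
Context {R : realType}.

Lemma measure_bigsetU_seq_le {dT} {T : measurableType dT} (mu : {measure set T -> \bar R})
    (I : eqType) (s : seq I) (A : I -> set T) :
  (forall i, i \in s -> measurable (A i)) ->
  (mu (\big[setU/set0]_(i <- s) A i) <= \sum_(i <- s) mu (A i))%E.
Proof.
elim: s => [|i s IH] mA; first by rewrite !big_nil measure0.
rewrite !big_cons; apply: (le_trans (measureU2 _ _ _)).
- by apply: mA; rewrite mem_head.
- rewrite big_seq; apply: bigsetU_measurable => j js.
  by apply: mA; rewrite inE js orbT.
- by apply: leeD => //; apply: IH => j js; apply: mA; rewrite inE js orbT.
Qed.

(** The bounded quantity is the expectation of e^(lam (a - B)) for B Bernoulli of parameter [s]. The
    sign of [lam] selects the tail: the last premise reads [s >= a + lam] for positive and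
    [s <= a + lam] for negative [lam], and [rho] is uniform in such [s]. *)
Lemma chernoff_rate (a lam : R) : 0 < a < 1 -> -1 < lam < 1 -> lam != 0 ->
  exists2 rho, 0 < rho < 1 & forall s, 0 <= s <= 1 -> lam ^+ 2 <= lam * (s - a) ->
    s * expR (lam * (a - 1)) + (1 - s) * expR (lam * a) <= rho.
Proof.
move=> /andP[a0 a1] /andP[lN1 l1] lam0.
have l2 : 0 < lam ^+ 2 by rewrite exprn_even_gt0.
have D1 : 0 < 1 + lam * (1 - a) by nra.
have D2 : 0 < 1 - lam * a by nra.
pose D := (1 + lam * (1 - a)) * (1 - lam * a).
have D0 : 0 < D by rewrite mulr_gt0.
(* e^(-x) <= 1/(1+x) bounds the left-hand side by
   s/(1 + lam (1-a)) + (1-s)/(1 - lam a). *)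
exists (Num.max 2^-1 ((1 + lam * (1 - 2 * a) - lam ^+ 2) / D)).
  (* The entry 1/2 secures positivity. The fraction is below 1 because [D] exceeds its numerator by
     lam^2 (1 - a (1 - a)). *)
  rewrite lt_max invr_gt0 ltr0n gt_max invf_lt1 ?ltr1n //= ltr_pdivrMr // mul1r /D; nra.
move=> s /andP[s0 s1] sl; rewrite le_max; apply/orP; right.
rewrite ler_pdivlMr //.
have e1 : expR (lam * (a - 1)) * (1 + lam * (1 - a)) <= 1.
  rewrite (_ : lam * (a - 1) = - (lam * (1 - a))); last by ring.
  by rewrite expRN mulrC ler_pdivrMr ?expR_gt0 // mul1r expR_ge1Dx.
have e2 : expR (lam * a) * (1 - lam * a) <= 1.
  rewrite (_ : expR (lam * a) = (expR (- (lam * a)))^-1); last by rewrite expRN invrK.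
  rewrite mulrC ler_pdivrMr ?expR_gt0 // mul1r.
  exact: expR_ge1Dx.
rewrite /D.
have h1 : s * expR (lam * (a - 1)) * ((1 + lam * (1 - a)) * (1 - lam * a)) <= s * (1 - lam * a).
  rewrite -mulrA ler_wpM2l // mulrA -[leRHS]mul1r ler_wpM2r //; exact: ltW.
have h2 : (1 - s) * expR (lam * a) * ((1 + lam * (1 - a)) * (1 - lam * a))
    <= (1 - s) * (1 + lam * (1 - a)).
  rewrite -mulrA ler_wpM2l ?subr_ge0 // mulrCA -[leRHS]mulr1 ler_wpM2l //; exact: ltW.
(* The two right-hand sides add up to 1 + lam (1 - a) - lam s, and [sl] bounds lam s below by lam^2
   + lam a. *)
rewrite mulrDl (le_trans (lerD h1 h2)) //; nra.
Qed.

Context {dO dT} {Omega : measurableType dO} {T : measurableType dT}.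

Lemma chernoff_bound (P : probability Omega R) (n : nat) (Z : 'I_n -> Omega -> T)
    (B : set T) (s lam a : R) :
  measurable B -> (forall i, measurable_fun setT (Z i)) ->
  mutually_independent P Z -> (forall i, P (Z i @^-1` B) = s%:E) ->
  (P [set w | (0 <= lam * (n%:R * a - \sum_(i < n) \1_B (Z i w)))%R] <=
   ((s * expR (lam * (a - 1)) + (1 - s) * expR (lam * a)) ^+ n)%:E)%E.
Proof.
move=> mB mZ indep PZ.
(* Sum over the patterns b of memberships of the Z i in B, weighting each good
   pattern by e^(lam (n a - |b|)) >= 1: the sum over all patterns factorizes. *)
pose A (b : {ffun 'I_n -> bool}) i := if b i then B else ~` B.
pose q (b : bool) := if b then s else 1 - s.
have mA b i : measurable (A b i) by rewrite /A; case: ifP => // _; exact: measurableC.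
have mZA b i : measurable (Z i @^-1` A b i) by rewrite -[X in measurable X]setTI; exact: mZ.
have PZA b i : P (Z i @^-1` A b i) = (q (b i))%:E.
  rewrite /A /q; case: (b i) => //.
  rewrite preimage_setC probability_setC ?PZ //.
  by rewrite -[X in measurable X]setTI; exact: mZ.
pose good (b : {ffun 'I_n -> bool}) := 0 <= lam * (n%:R * a - \sum_(i < n) (b i)%:R).
have q0 (b : {ffun 'I_n -> bool}) i : 0 <= q (b i) by rewrite -lee_fin -(PZA b).
rewrite (_ : [set w | _] = \big[setU/set0]_(b <- [seq b <- enum {ffun 'I_n -> bool} | good b])
   \big[setI/setT]_(i < n) (Z i @^-1` A b i)); last first.
  rewrite -bigcup_seq; apply/seteqP; split => w /=.
    move=> Hw; exists [ffun i => Z i w \in B].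
      rewrite /= mem_filter mem_enum inE andbT /good.
      by under eq_bigr do rewrite ffunE -indicE.
    rewrite -bigcap_seq => i _ /=; rewrite /A ffunE; case: ifPn; first exact: set_mem.
    by move=> /negP + /= => H Bz; apply: H; exact: mem_set.
  move=> [b /=]; rewrite mem_filter => /andP[gb _]; rewrite -bigcap_seq => Hb.
  move: gb; rewrite /good; congr (_ <= _ * (_ - _)); apply: eq_bigr => i _.
  have := Hb i (mem_index_enum i); rewrite /= /A indicE; case: (b i) => [/mem_set ->//|].
  by move=> /= Zi; rewrite memNset.
apply: (le_trans (measure_bigsetU_seq_le P _ _ _ _)).
  by move=> b _; apply: bigsetI_measurable.
rewrite big_filter big_enum_cond /=.
under eq_bigr do rewrite indep //.
under eq_bigr do under eq_bigr do rewrite PZA.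
under eq_bigr do rewrite prodEFin.
rewrite sumEFin lee_fin.
apply: (@le_trans _ _ (\sum_(b : {ffun 'I_n -> bool})
    \prod_(i < n) (q (b i) * expR (lam * (a - (b i)%:R))))).
  rewrite [leRHS](bigID good) /= -[leLHS]addr0 lerD //; last first.
    by apply: sumr_ge0 => b _; apply: prodr_ge0 => i _; rewrite mulr_ge0 // expR_ge0.
  apply: ler_sum => b gb; rewrite big_split /= -expR_sum.
  rewrite ler_peMr ?prodr_ge0 // -[leLHS]expR0 ler_expR.
  rewrite -mulr_sumr sumrB sumr_const card_ord -[a *+ n]mulr_natl; exact: gb.
rewrite -(bigA_distr_bigA (fun i (b : bool) => q b * expR (lam * (a - b%:R)))).
under eq_bigr do rewrite big_bool /= subr0.
by rewrite prodr_const card_ord.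
Qed.

End tail_bounds.

(** * Deviation of a single empirical quantile *)

Section empirical_quantiles.
Context {R : realType}.

Lemma emp_quantile_le (n : nat) (ys : 'I_n -> R) (a y : R) : (0 < n)%N -> 0 < a < 1 ->
  (quantile (emp_cdf ys) a <= y) = (a <= emp_cdf ys y).
Proof.
move=> n0 /andP[a0 a1]; have n0R : 0 < n%:R :> R by rewrite ltr0n.
apply: quantile_le.
- move=> x z xz; rewrite ler_wpM2r ?invr_ge0 ?ler0n //; apply: ler_sum => i _.
  by case: ifPn => [/le_trans/(_ xz) ->//|_]; case: ifP.
(* The empirical CDF is constant from [x] up to the next sample point; [e] is the distance to it,
   capped at 1, and [e / 2] stops short of it. *)
- move=> x xa; pose e := \big[Num.min/1]_(i | x < ys i) (ys i - x).
  have e0 : 0 < e by rewrite lt_bigmin // => i; rewrite subr_gt0.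
  exists (e / 2); first by rewrite divr_gt0.
  rewrite (_ : emp_cdf ys (x + e / 2) = emp_cdf ys x) //.
  congr (_ / _); apply: eq_bigr => i _; congr (if _ then _ else _).
  case: (leP (ys i) x) => [yx|xy]; first by rewrite (le_trans yx) // lerDl divr_ge0 // ltW.
  apply/negbTE; rewrite -ltNge -ltrBrDl (@lt_le_trans _ _ e) //; last exact: bigmin_le_cond.
  by rewrite gtr_pMr // invf_lt1 // ltr1n.
- exists (\big[Num.max/0]_i ys i); rewrite /emp_cdf (eq_bigr (fun=> 1)).
    by rewrite sumr_const card_ord divff ?gt_eqF // ltW.
  by move=> i _; rewrite le_bigmax.
- exists (\big[Num.min/0]_i ys i - 1); rewrite /emp_cdf big1 ?mul0r // => i _.
  rewrite leNgt (@lt_le_trans _ _ (\big[Num.min/0]_i ys i)) //.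
    by rewrite ltrBlDr ltrDl.
  exact: bigmin_le_cond.
Qed.

Context {dO dT} {Omega : measurableType dO} {T : measurableType dT}.
Variables (P : probability Omega R) (eta : T -> R).
Hypothesis meta : measurable_fun setT eta.

Let sublevel y := eta @^-1` [set z | z <= y].

Let msublevel y : measurable (sublevel y).
Proof.
rewrite /sublevel (_ : [set z | z <= y] = `]-oo, y]%classic) //.
by rewrite -[X in measurable X]setTI; exact: meta.
Qed.

Section one_sample.
Variables (n : nat) (Z : 'I_n -> Omega -> T).
Hypothesis n0 : (0 < n)%N.
Hypothesis mZ : forall i, measurable_fun setT (Z i).
Variable a : R.
Hypothesis a01 : 0 < a < 1.

Let qhat w := quantile (emp_cdf (fun i => eta (Z i w))) a.

Let emp_cdfE w y :
  emp_cdf (fun i => eta (Z i w)) y = (\sum_(i < n) \1_(sublevel y) (Z i w)) / n%:R.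
Proof.
congr (_ / _); apply: eq_bigr => i _; rewrite indicE; case: ifPn => h.
  by rewrite mem_set.
by rewrite memNset //; exact/negP.
Qed.

Lemma measurable_emp_quantile : measurable_fun setT qhat.
Proof.
move=> mD; apply: (measurability _ (RGenOInfty.measurableE R)) => // B [_ [y ->] <-].
rewrite setTI (_ : _ @^-1` _ =
    (fun w => (\sum_(i < n) \1_(sublevel y) (Z i w)) / n%:R) @^-1` `]-oo, a[).
  rewrite -[X in measurable X]setTI.
  apply: (_ : measurable_fun setT _) => //.
  apply: measurable_funM => //; apply: measurable_sum => i.
  by apply: measurableT_comp => //; exact: measurable_indic.
apply/seteqP; split => w /=; rewrite !in_itv /= andbT -emp_cdfE !ltNge /qhat emp_quantile_le //.
Qed.

Variable Q : probability T R.
Hypothesis ZQ : forall i A, measurable A -> P (Z i @^-1` A) = Q A.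
Hypothesis indep : mutually_independent P Z.

Let G y := fine (Q (sublevel y)).

Let GE y i : P (Z i @^-1` sublevel y) = (G y)%:E.
Proof. by rewrite ZQ // /G fineK // fin_num_measure. Qed.

Let G01 y : 0 <= G y <= 1.
Proof.
rewrite fine_ge0 //= -lee_fin /G fineK ?probability_le1 // fin_num_measure //.
Qed.

(** If [qhat] exceeds [x + dl], fewer than [n a] observations are at most [x + dl], although each is
    with probability at least [a + lam]; if it is below [x - dl], at least [n a] are at most
    [x - dl], each with probability at most [a - lam]. The Chernoff bound with [lam] and with
    [- lam] controls the two events. *)
Lemma emp_quantile_deviation (x dl lam rho rho' : R) : 0 < lam ->
  (forall s, 0 <= s <= 1 -> lam ^+ 2 <= lam * (s - a) ->
    s * expR (lam * (a - 1)) + (1 - s) * expR (lam * a) <= rho) ->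
  (forall s, 0 <= s <= 1 -> (- lam) ^+ 2 <= - lam * (s - a) ->
    s * expR (- lam * (a - 1)) + (1 - s) * expR (- lam * a) <= rho') ->
  a + lam <= G (x + dl) -> G (x - dl) <= a - lam ->
  (P [set w | (dl < `|qhat w - x|)%R] <= (rho ^+ n + rho' ^+ n)%:E)%E.
Proof.
move=> lam0 hrho hrho' Gp Gm.
have bnd (l r y : R) : l ^+ 2 <= l * (G y - a) ->
    (forall s, 0 <= s <= 1 -> l ^+ 2 <= l * (s - a) ->
      s * expR (l * (a - 1)) + (1 - s) * expR (l * a) <= r) ->
    (P [set w | (0 <= l * (n%:R * a - \sum_(i < n) \1_(sublevel y) (Z i w)))%R] <= (r ^+ n)%:E)%E.
  move=> lG hr; apply: le_trans (chernoff_bound P n Z _ (G y) l a _ mZ indep (GE y)) _ => //.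
  rewrite lee_fin lerXn2r ?nnegrE ?hr //.
    by have /andP[? ?] := G01 y; rewrite addr_ge0 // mulr_ge0 ?expR_ge0 // subr_ge0.
  have /andP[? ?] := G01 y; apply: le_trans (hr _ (G01 y) lG).
  by rewrite addr_ge0 // mulr_ge0 ?expR_ge0 // subr_ge0.
have n0R : 0 < n%:R :> R by rewrite ltr0n.
have mev l y :
    measurable [set w | (0 <= l * (n%:R * a - \sum_(i < n) \1_(sublevel y) (Z i w)))%R].
  rewrite (_ : [set w | _] =
    (fun w => l * (n%:R * a - \sum_(i < n) \1_(sublevel y) (Z i w))) @^-1` `[0, +oo[).
    rewrite -[X in measurable X]setTI.
    apply: (_ : measurable_fun setT _) => //.
    apply: measurable_funM => //; apply: measurable_funB => //; apply: measurable_sum => i.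
    by apply: measurableT_comp => //; exact: measurable_indic.
  by apply/seteqP; split => w /=; rewrite in_itv /= andbT.
rewrite EFinD; apply: le_trans (leeD (bnd lam rho (x + dl) _ hrho)
  (bnd (- lam) rho' (x - dl) _ hrho')).
- apply: le_trans (measureU2 _ (mev _ _) (mev _ _)).
  apply: le_measure; rewrite ?inE.
  + rewrite (_ : [set w | _] = ~` (qhat @^-1` `[x - dl, x + dl])).
      apply: measurableC; rewrite -[X in measurable X]setTI; exact: measurable_emp_quantile.
    by apply/seteqP; split => w /=; rewrite in_itv /= -ler_distl ltNge => /negP.
  + exact: measurableU.
  + move=> w /=; rewrite ltNge ler_distl negb_and -!ltNge => /orP[].
      move=> /ltW; rewrite /qhat emp_quantile_le // emp_cdfE ler_pdivlMr // => h; right.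
      by rewrite nmulr_rge0 ?oppr_lt0 // subr_le0 mulrC.
    rewrite ltNge /qhat emp_quantile_le // -ltNge emp_cdfE ltr_pdivrMr // => h; left.
    by rewrite pmulr_rge0 // subr_ge0 ltW // mulrC.
- by rewrite expr2 ler_pM2l // lerBrDl.
- by rewrite expr2 ler_nM2l ?oppr_lt0 // lerBlDl.
Qed.

End one_sample.
End empirical_quantiles.

(** * Consistency *)

Section auxiliary_analysis.
Context {R : realType}.

(** Writing rho^n = e^(-c n) and taking an integer [k] at least [beta], the Taylor term of order k+1
    of e^(c n) yields the bound M / n. *)
Lemma cvg_powR_geometric (K beta rho : R) : 0 < rho < 1 ->
  (fun n : nat => K * (n%:R `^ beta) * rho ^+ n) @ \oo --> 0.
Proof.
move=> /andP[rho0 rho1].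
pose c := - ln rho; have c0 : 0 < c by rewrite oppr_gt0 ln_lt0 // rho0 rho1.
pose k := (Num.truncn beta).+1.
have bk : beta <= k%:R by rewrite ltW // truncnS_gt.
pose M := k.+1`!%:R / c ^+ k.+1.
have M0 : 0 <= M by rewrite divr_ge0 // exprn_ge0 // ltW.
have bnd n : (0 < n)%N -> n%:R `^ beta * rho ^+ n <= M / n%:R.
  move=> n0; have n0R : 0 < n%:R :> R by rewrite ltr0n.
  have cn : 0 <= c * n%:R by rewrite mulr_ge0 ?ltW.
  have rhoE : rho ^+ n = (expR (c * n%:R))^-1.
    by rewrite -expRN mulNr opprK mulrC expRM_natl lnK.
  have h1 : n%:R `^ beta <= n%:R ^+ k by rewrite -powR_mulrn // ler_powR // ler1n.
  have h2 : (c * n%:R) ^+ k.+1 / k.+1`!%:R <= expR (c * n%:R).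
    by apply: (le_trans _ (expR_ge1Dxn k cn)); rewrite lerDr.
  have c1 : 0 < (c * n%:R) ^+ k.+1 / k.+1`!%:R.
    by rewrite divr_gt0 ?exprn_gt0 ?mulr_gt0 // ltr0n fact_gt0.
  apply: (@le_trans _ _ (n%:R ^+ k * ((c * n%:R) ^+ k.+1 / k.+1`!%:R)^-1)).
    rewrite rhoE ler_pM ?powR_ge0 ?invr_ge0 ?expR_ge0 // lef_pV2 ?posrE ?expR_gt0 //.
  have ck0 : c ^+ k.+1 != 0 by rewrite expf_neq0 ?gt_eqF.
  have nk0 : n%:R ^+ k != 0 :> R by rewrite expf_neq0 ?gt_eqF.
  have f0 : k.+1`!%:R != 0 :> R by rewrite pnatr_eq0 -lt0n fact_gt0.
  have fld (C N F m : R) : C != 0 -> N != 0 -> F != 0 -> m != 0 ->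
      N * ((C * (m * N)) / F)^-1 = F / C / m.
    by move=> C0 N0 F0 m0; field; rewrite m0 C0 F0 N0.
  by rewrite exprMn (exprS n%:R k) /M fld // gt_eqF.
apply/cvgr0Pnorm_le => e e0.
have : (fun n => `|K| * M * n%:R^-1) @ \oo --> (`|K| * M * 0 : R).
  apply: cvgMr; rewrite gtr0_cvgV0; first exact: cvgr_idn.
  by near=> n; rewrite ltr0n; near: n; exact: nbhs_infty_gt.
rewrite mulr0 => /cvgr0Pnorm_le/(_ _ e0) He.
near=> n.
have n0 : (0 < n)%N by near: n; exact: nbhs_infty_gt.
apply: le_trans (near He n _) => //.
have X0 : 0 <= n%:R `^ beta * rho ^+ n by rewrite mulr_ge0 ?powR_ge0 ?exprn_ge0 // ltW.
rewrite -mulrA normrM (ger0_norm X0).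
by apply: (le_trans (ler_wpM2l (normr_ge0 K) (bnd n n0))); rewrite mulrA ler_norm.
Unshelve. all: by end_near. Qed.

(** Row vectors carry the maximum norm, while the mesh of the grid is Euclidean; this passes from
    the latter to the former. *)
Lemma le_mxnorm_norm2 p (v : 'rV[R]_p) : `|v| <= norm2 v.
Proof.
rewrite [leLHS]mx_normrE; apply/bigmax_leP; split => [|[i j] _ /=].
  exact: sqrtr_ge0.
rewrite ord1 -sqrtr_sqr ler_wsqrtr // (bigD1 j) //= lerDl.
by apply: sumr_ge0 => k _; exact: sqr_ge0.
Qed.

Lemma norm2_continuous p : continuous (@norm2 R p).
Proof.
move=> v; apply: (continuous_comp (f := fun v : 'rV[R]_p => \sum_(j < p) v ord0 j ^+ 2)).
  have : continuous (fun v : 'rV[R]_p => \sum_(j < p) v ord0 j ^+ 2).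
    apply: continuous_big => [|j _ x]; first exact: add_continuous.
    have cj : (fun v : 'rV[R]_p => v ord0 j) @ x --> x ord0 j by exact: coord_continuous.
    exact: (cvgM cj cj).
  exact.
exact: sqrt_continuous.
Qed.

(** Being within [e / 2] of [G], the function [G'] is still above [a] at [q + dl] and strictly below
    [a] at [q - dl], which traps [q']. *)
Lemma quantile_perturbation (G G' : R -> R) (a q q' dl e : R) :
  (forall y, (q <= y) = (a <= G y)) -> (forall y, (q' <= y) = (a <= G' y)) ->
  0 < e -> a + e <= G (q + dl) -> G (q - dl) <= a - e ->
  (forall y, G y <= G' y + e / 2) -> (forall y, G' y <= G y + e / 2) ->
  `|q - q'| <= dl.
Proof.
move=> qG q'G e0 Gp Gm GG' G'G; rewrite distrC ler_distl; apply/andP; split.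
  rewrite leNgt; apply/negP => /ltW; rewrite q'G => h.
  have := G'G (q - dl); lra.
rewrite q'G; have := GG' (q + dl); lra.
Qed.

(** The parameters at distance at least [h] from [th] form a compact set, on which [Q] attains a
    minimum; uniqueness puts it strictly above [Q th]. *)
Lemma compact_unique_min_gap p (Theta : set 'rV[R]_p) (Q : 'rV[R]_p -> R) th h :
  compact Theta -> {within Theta, continuous Q} ->
  (forall th', Theta th' -> Q th <= Q th') ->
  (forall th', Theta th' -> Q th' <= Q th -> th' = th) -> 0 < h ->
  exists2 g, 0 < g & forall th', Theta th' -> h < norm2 (th' - th) -> Q th + g <= Q th'.
Proof.
move=> cT cQ minQ uniqQ h0.
pose far := Theta `&` [set th' | h <= norm2 (th' - th)].
have cfar : compact far.
  apply: compact_closedI => //.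
  have -> : [set th' | h <= norm2 (th' - th)] = (fun th' => norm2 (th' - th)) @^-1` `[h, +oo[.
    by apply/seteqP; split => th' /=; rewrite in_itv /= andbT.
  apply: (continuous_closedP _).1; last exact: interval_closed.
  move=> th'; apply: (@continuous_comp _ _ _ (fun x : 'rV[R]_p => x - th) (@norm2 R p)).
    exact: (@cvgB _ _ _ (nbhs th') _ id (cst th) th' th cvg_id (cvg_cst _)).
  exact: norm2_continuous.
have [far0|/set0P far0] := eqVneq far set0.
  (* No parameter is that far away, so any positive gap will do. *)
  exists 1 => // th' Tth' hth'; exfalso.
  by rewrite -[False]/(set0 th') -far0; split => //=; exact: ltW.
have [] := compact_EVT_min far0 cfar (continuous_subspaceW _ cQ).
  by move=> ? [].
move=> th1; rewrite inE => -[T1 h1] min1; exists (Q th1 - Q th).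
  rewrite subr_gt0 ltNge; apply/negP => /(uniqQ _ T1) e; move: h1.
  rewrite /= e subrr /norm2 big1 ?sqrtr0 ?leNgt ?h0 // => i _.
  by rewrite mxE expr0n.
by move=> th' Tth' hth'; rewrite subrKC min1 // inE; split => //=; exact: ltW.
Qed.

End auxiliary_analysis.

Theorem theorem1
  (R : realType) (d p : nat) (hd : (0 < d)%N) (hp : (0 < p)%N)
  (* eta : R^d -> R measurable *)
  (eta : d.-tuple R -> R) (heta : measurable_fun setT eta)
  (* marginal distributions P_1, ..., P_d on R *)
  (Pm : 'I_d -> probability R R)
  (* compact parameter set *)
  (Theta : set 'rV[R]_p) (hTheta : compact Theta)
  (* copula family C_theta, and the distributions P_theta on R^d *)
  (C : 'rV[R]_p -> d.-tuple R -> R)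
  (hC : forall th, Theta th -> is_copula (C th))
  (Pth : 'rV[R]_p -> probability (d.-tuple R) R)
  (hPth : forall th, Theta th -> forall x : d.-tuple R,
      Pth th (orthant x) =
      (C th [tuple fine (Pm j [set y | y <= tnth x j]) | j < d])%:E)
  (* (A1) densities *)
  (f : 'rV[R]_p -> d.-tuple R -> R) (c : 'rV[R]_p -> 'rV[R]_d -> R)
  (hf : forall th, Theta th -> has_density (Pth th) (f th))
  (hc : forall th, Theta th ->
      cdf_has_density (C th) (fun u => c th (tuple2row u)))
  (hc_cont : {within Theta `*` [set u : 'rV[R]_d | forall j, 0 <= u ord0 j <= 1],
               continuous (fun z : 'rV[R]_p * 'rV[R]_d => c z.1 z.2)})
  (alpha : R) (halpha : 0 < alpha < 1) :
  (* G_theta : CDF of eta(X), X ~ P_theta *)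
  let G := fun th y => fine (Pth th (eta @^-1` [set z | z <= y])) in
  let Gstar := inf [set quantile (G th) alpha | th in Theta] in
  (* (A2) *)
  (forall th, Theta th -> continuous (G th)) ->
  (* (A3) *)
  (forall th, Theta th -> {homo G th : x y / x < y}) ->
  (exists epsl : R -> R, (forall delta, 0 < delta -> 0 < epsl delta) /\
     forall th, Theta th -> forall delta, 0 < delta ->
       epsl delta <= mod_incr (G th) delta (quantile (G th) alpha)) ->
  forall (ThetaN : nat -> seq 'rV[R]_p),
  (forall N, (1 <= N)%N ->
     [/\ uniq (ThetaN N), size (ThetaN N) = N &
         forall th, th \in ThetaN N -> Theta th]) ->
  (* sup_{theta in Theta} min_{theta' in Theta_N} ||theta - theta'||_2 -> 0 *)
  (forall e, 0 < e -> exists N0, forall N, (N0 <= N)%N -> (1 <= N)%N ->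
     forall th, Theta th -> exists2 th', th' \in ThetaN N & norm2 (th - th') <= e) ->
  forall (Nn : nat -> nat) (K beta : R), 0 < K -> 0 < beta ->
  (forall n, (1 <= n)%N -> (1 <= Nn n)%N /\ (Nn n)%:R <= K * (n%:R `^ beta)) ->
  (forall M, exists n0, forall n, (n0 <= n)%N -> (M <= Nn n)%N) ->
  (* the samples, all defined on one probability space *)
  forall (dO : measure_display) (Omega : measurableType dO)
         (P : probability Omega R)
         (X : forall n : nat, 'rV[R]_p -> 'I_n -> Omega -> d.-tuple R),
  (forall n th, th \in ThetaN (Nn n) ->
     [/\ forall i, measurable_fun setT (X n th i),
         forall i A, measurable A -> P (X n th i @^-1` A) = Pth th A &
         mutually_independent P (X n th)]) ->
  (* empirical quantile of the sample for theta *)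
  let Ghatinv := fun n th w =>
      quantile (emp_cdf (fun i : 'I_n => eta (X n th i w))) alpha in
  forall thetahat : nat -> Omega -> 'rV[R]_p,
  (forall n, (1 <= n)%N -> forall w,
     thetahat n w \in ThetaN (Nn n) /\
     forall th, th \in ThetaN (Nn n) -> Ghatinv n (thetahat n w) w <= Ghatinv n th w) ->
  (forall n, (1 <= n)%N -> forall th, th \in ThetaN (Nn n) ->
     measurable [set w | thetahat n w = th]) ->
  (forall eps, 0 < eps ->
     (fun n => P [set w | eps < `|Ghatinv n (thetahat n w) w - Gstar|])
       @ \oo --> 0%E) /\
  (forall thstar, Theta thstar ->
     (forall th, Theta th -> quantile (G thstar) alpha <= quantile (G th) alpha) ->
     (forall th, Theta th ->
        (forall th', Theta th' -> quantile (G th) alpha <= quantile (G th') alpha) ->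
        th = thstar) ->
     forall h, 0 < h ->
       (fun n => P [set w | h < norm2 (thetahat n w - thstar)]) @ \oo --> 0%E).
Proof.
move=> G Gstar cG sG [epsl [epsl0 hepsl]] ThetaN hN hnet Nn K beta K0 beta0 hNn hNinf
  dO Omega P X hX Ghatinv thetahat hmin mthat.
pose Q th := quantile (G th) alpha.
have qG th y : (Q th <= y) = (alpha <= G th y).
  exact: (quantile_rv_le (Pth th) eta heta).
have GQ th : Theta th -> G th (Q th) = alpha.
  by move=> Tth; apply: (cdf_quantile (Pth th) eta heta _ halpha); exact: cG.
have Gp th dl : Theta th -> 0 < dl -> alpha + epsl dl <= G th (Q th + dl).
  move=> Tth dl0; have := hepsl th Tth dl dl0.
  by rewrite /mod_incr le_min -/(Q th) GQ // lerBrDl => /andP[].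
have Gm th dl : Theta th -> 0 < dl -> G th (Q th - dl) <= alpha - epsl dl.
  move=> Tth dl0; have := hepsl th Tth dl dl0.
  by rewrite /mod_incr le_min -/(Q th) GQ // => /andP[_]; rewrite lerBrDl addrC -lerBrDl.
have msub y : measurable (eta @^-1` [set z | z <= y]).
  rewrite (_ : [set z | z <= y] = `]-oo, y]%classic) //.
  by rewrite -[X in measurable X]setTI; exact: heta.
have Gle th th' e : Theta th -> Theta th' -> 0 <= e ->
    (forall u, row_cube u -> `|c th u - c th' u| <= e) -> forall y, G th y <= G th' y + e.
  move=> Tth Tth' e0 cle y; rewrite -lee_fin EFinD /G !fineK ?fin_num_measure //.
  apply: (copula_model_le Pm (C th) (C th') (c th) (c th')) => //.
  - exact: hC.
  - exact: hC.
  - exact: hc.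
  - exact: hc.
  - exact: (copula_density_section Theta c th hc_cont Tth).
  - exact: (copula_density_section Theta c th' hc_cont Tth').
  - exact: hPth.
  - exact: hPth.
  - by move=> u /cle; rewrite ler_distl => /andP[].
have cQ : {within Theta, continuous Q}.
  apply/subspace_continuousP => th Tth; apply/cvgrPdist_le => e e0.
  (* Densities within half the modulus of increase at [e] give CDFs that close, and then quantiles
     within [e]. *)
  have e'0 : 0 < epsl e / 2 by rewrite divr_gt0 // epsl0.
  have := copula_density_near Theta c th hc_cont Tth _ e'0.
  rewrite !near_withinE; apply: filterS => th' cth' Tth'.
  apply: (quantile_perturbation (G th) (G th') alpha _ _ _ (epsl e)) => //.
  - exact: epsl0.
  - exact: Gp.
  - exact: Gm.
  - by apply: Gle => //; [exact: ltW|move=> u Ku; apply: ltW; exact: cth'].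
  - apply: Gle => //; [exact: ltW|move=> u Ku; apply: ltW; rewrite distrC; exact: cth'].
have [th0 T0 min0] : exists2 th0, Theta th0 & forall th, Theta th -> Q th0 <= Q th.
  have Theta0 : Theta !=set0.
    (* [Theta] is nonempty because it contains the one-point grid. *)
    have [_ + T1] := hN 1%N isT; case: (ThetaN 1%N) T1 => // th s T1 _.
    by exists th; apply: T1; rewrite mem_head.
  have [th0] := compact_EVT_min Theta0 hTheta cQ; rewrite inE => T0 min0.
  by exists th0 => // th Tth; apply: min0; rewrite inE.
have GstarE : Gstar = Q th0.
  apply/eqP; rewrite eq_le; apply/andP; split.
    by apply: ge_inf; [exists (Q th0) => _ [th Tth <-]; exact: min0|exists th0].
  by apply: lb_le_inf; [exists (Q th0), th0|move=> _ [th Tth <-]; exact: min0].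
have inT n th : (0 < n)%N -> th \in ThetaN (Nn n) -> Theta th.
  by move=> n0; have [N1 _] := hNn n n0; have [_ _ +] := hN _ N1; apply.
pose dev n dl th := [set w | dl < `|Ghatinv n th w - Q th|].
pose bad n dl := \big[setU/set0]_(th <- ThetaN (Nn n)) dev n dl th.
have mGhat n th : (0 < n)%N -> th \in ThetaN (Nn n) -> measurable_fun setT (Ghatinv n th).
  move=> n0 /hX[mX _ _].
  exact: (measurable_emp_quantile eta heta n (X n th) n0 mX alpha halpha).
have mGhat_dist n th dl r : (0 < n)%N -> th \in ThetaN (Nn n) ->
    measurable [set w | dl < `|Ghatinv n th w - r|].
  move=> n0 inth; rewrite (_ : [set w | _] = (fun w => `|Ghatinv n th w - r|) @^-1` `]dl, +oo[).
    rewrite -[X in measurable X]setTI.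
    apply: (_ : measurable_fun setT _) => //.
    apply: measurableT_comp => //; apply: measurable_funB => //; exact: mGhat.
  by apply/seteqP; split => w /=; rewrite in_itv /= andbT.
have mbad n dl : (0 < n)%N -> measurable (bad n dl).
  move=> n0; rewrite /bad big_seq; apply: bigsetU_measurable => th inth.
  exact: mGhat_dist.
have notbad n dl w th : ~ bad n dl w -> th \in ThetaN (Nn n) -> `|Ghatinv n th w - Q th| <= dl.
  move=> nb inth; rewrite leNgt; apply/negP => h; apply: nb.
  by rewrite /bad -bigcup_seq; exists th.
have Pbad dl : 0 < dl -> (fun n => P (bad n dl)) @ \oo --> 0%E.
  (* The cap 1/2 puts [lam] and [- lam] in the range of [chernoff_rate], while [lam] stays below the
     modulus of increase at [dl]. *)
  move=> dl0; pose lam := Num.min (epsl dl) 2^-1.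
  have lam0 : 0 < lam by rewrite lt_min epsl0 // invr_gt0 ltr0n.
  have lam1 : lam < 1 by rewrite gt_min invf_lt1 ?ltr1n ?orbT.
  have lame : lam <= epsl dl by rewrite ge_min lexx.
  have lamb : -1 < lam < 1 by rewrite lam1 andbT; lra.
  have lamNb : -1 < - lam < 1 by apply/andP; split; lra.
  have [rho /[dup] rho01 /andP[rho0 _] hrho] := chernoff_rate _ _ halpha lamb (lt0r_neq0 lam0).
  have [|rho' /[dup] rho'01 /andP[rho'0 _] hrho'] := chernoff_rate _ _ halpha lamNb.
    by rewrite oppr_eq0 lt0r_neq0.
  pose u (n : nat) := K * (n%:R `^ beta) * rho ^+ n + K * (n%:R `^ beta) * rho' ^+ n.
  have cvgu : (fun n => (u n)%:E) @ \oo --> 0%E.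
    apply: cvg_EFin; first exact: nearW.
    by rewrite -[X in _ --> X]addr0; apply: cvgD; exact: cvg_powR_geometric.
  apply: (squeeze_cvge _ (cvg_cst 0%E) cvgu) => //.
  near=> n; have n0 : (0 < n)%N by near: n; exact: nbhs_infty_gt.
  apply/andP; split; first exact: measure_ge0.
  have [N1 NK] := hNn n n0; have [_ sN _] := hN _ N1.
  have rr0 : 0 <= rho ^+ n + rho' ^+ n by rewrite addr_ge0 // exprn_ge0 // ltW.
  apply: (le_trans (measure_bigsetU_seq_le P _ _ _ _)).
    by move=> th inth; exact: mGhat_dist.
  apply: (@le_trans _ _ (\sum_(th <- ThetaN (Nn n)) (rho ^+ n + rho' ^+ n)%:E)%E).
    rewrite big_seq [leRHS]big_seq; apply: lee_sum => th inth.
    have [mX lX iX] := hX n th inth; have Tth := inT n th n0 inth.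
    apply: (emp_quantile_deviation P eta heta n (X n th) n0 mX alpha halpha (Pth th) lX iX).
    - exact: lam0.
    - exact: hrho.
    - exact: hrho'.
    - by apply: le_trans (Gp th dl Tth dl0); rewrite lerD2l.
    - by apply: le_trans (Gm th dl Tth dl0) _; rewrite lerD2l lerN2.
  rewrite sumEFin lee_fin big_const_seq count_predT sN iter_addr addr0 -mulr_natl /u -mulrDr.
  exact: ler_wpM2r.
have squeeze_bad dl (E : nat -> set Omega) : 0 < dl ->
    (forall n, (0 < n)%N -> measurable (E n)) ->
    (\forall n \near \oo, E n `<=` bad n dl) -> (fun n => P (E n)) @ \oo --> 0%E.
  move=> dl0 mE Ebad; apply: (squeeze_cvge _ (cvg_cst 0%E) (Pbad dl dl0)).
  near=> n; have n0 : (0 < n)%N by near: n; exact: nbhs_infty_gt.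
  rewrite measure_ge0 le_measure ?inE; [by []|exact: mE|exact: mbad|].
  by near: n.
(* For a grid point [th'] near [th0], the argmin property bounds the minimal empirical quantile by
   that of [th'], hence by [Q th' + dl] and by [Q th0 + 2 * dl]. Off the bad event
   [Q (thetahat n w)] is within [dl] of it, which gives the lower bound and the factor 3. *)
have ontarget dl : 0 < dl -> \forall n \near \oo, forall w, ~ bad n dl w ->
    Q th0 - dl <= Ghatinv n (thetahat n w) w <= Q th0 + 2 * dl /\
    Q (thetahat n w) <= Q th0 + 3 * dl.
  move=> dl0.
  have : \forall th \near within Theta (nbhs th0), `|Q th0 - Q th| <= dl.
    by move/subspace_continuousP : cQ => /(_ th0 T0) /cvgrPdist_le; apply.
  rewrite near_withinE => /nbhs_ballP[r /= r0 near0].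
  (* The mesh bound is not strict whereas the ball is open, hence [r / 2]. *)
  have r20 : 0 < r / 2 by rewrite divr_gt0.
  have [N0 hN0] := hnet _ r20; have [n1 hn1] := hNinf N0.
  near=> n => w nb; have n0 : (0 < n)%N by near: n; exact: nbhs_infty_gt.
  have [N1 _] := hNn n n0.
  have n1n : (n1 <= n)%N by near: n; exact: nbhs_infty_ge.
  have [th' inth' dth'] := hN0 (Nn n) (hn1 n n1n) N1 th0 T0.
  have /(_ (inT n th' n0 inth')) : Theta th' -> `|Q th0 - Q th'| <= dl.
    apply: near0; rewrite mx_norm_ball /ball_ /=.
    apply: le_lt_trans (le_mxnorm_norm2 _ _) _; apply: le_lt_trans dth' _.
    by rewrite gtr_pMr // invf_lt1 // ltr1n.
  have [inhat /(_ th' inth') hat_le] := hmin n n0 w.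
  have := notbad n dl w th' nb inth'; have := notbad n dl w _ nb inhat.
  have := min0 _ (inT n _ n0 inhat).
  rewrite !ler_distl => h1 /andP[h2 h3] /andP[h4 h5] /andP[h6 h7].
  by split; [apply/andP; split|]; lra.
(* Measurability is obtained by splitting over the finitely many values of [thetahat]. *)
have mhat n (A : 'rV[R]_p -> set Omega) : (0 < n)%N ->
    (forall th, th \in ThetaN (Nn n) -> measurable (A th)) ->
    measurable [set w | A (thetahat n w) w].
  move=> n0 mA.
  rewrite (_ : [set w | _] =
      \big[setU/set0]_(th <- ThetaN (Nn n)) ([set w | thetahat n w = th] `&` A th)).
    rewrite big_seq; apply: bigsetU_measurable => th inth.
    by apply: measurableI; [exact: mthat|exact: mA].
  rewrite -bigcup_seq; apply/seteqP; split => w /=; last by move=> [th _ [-> ]].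
  by move=> Aw; exists (thetahat n w) => //=; have [] := hmin n n0 w.
split.
  (* With [dl] equal to [eps / 2], the upper deviation [2 * dl] is exactly [eps]. *)
  move=> eps eps0; have dl0 : 0 < eps / 2 by rewrite divr_gt0.
  apply: (squeeze_bad _ _ dl0) => [n n0|].
    apply: (mhat n (fun th => [set w | eps < `|Ghatinv n th w - Gstar|])) => // th inth.
    exact: mGhat_dist.
  near=> n => w /= epsw; apply: contrapT => nb.
  have [] : Q th0 - eps / 2 <= Ghatinv n (thetahat n w) w <= Q th0 + 2 * (eps / 2) /\
      Q (thetahat n w) <= Q th0 + 3 * (eps / 2).
    by move: w nb {epsw}; near: n; exact: ontarget.
  move: epsw; rewrite GstarE ltNge => /negP + /andP[h1 h2] _; apply.
  by rewrite ler_distl; apply/andP; split; lra.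
move=> thstar Tstar minstar uniqstar h h0.
have [g g0 gap] := compact_unique_min_gap _ _ _ thstar h hTheta cQ minstar
  (fun th Tth Qth => uniqstar th Tth (fun th' Tth' => le_trans Qth (minstar th' Tth'))) h0.
(* With [dl] equal to [g / 4], the excess [3 * dl] of [Q (thetahat n w)] stays below the gap [g]. *)
have dl0 : 0 < g / 4 by rewrite divr_gt0.
apply: (squeeze_bad _ _ dl0) => [n n0|].
  apply: (mhat n (fun th => [set w | h < norm2 (th - thstar)])) => // th inth.
  case: (ltP h (norm2 (th - thstar))) => hth.
    by rewrite (_ : [set w | _] = setT) //; apply/seteqP; split.
  by rewrite (_ : [set w | _] = set0) //; apply/seteqP; split.
near=> n => w /= hw; apply: contrapT => nb.
have n0 : (0 < n)%N by near: n; exact: nbhs_infty_gt.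
have [_] : Q th0 - g / 4 <= Ghatinv n (thetahat n w) w <= Q th0 + 2 * (g / 4) /\
    Q (thetahat n w) <= Q th0 + 3 * (g / 4).
  by move: w nb {hw}; near: n; exact: ontarget.
have [inhat _] := hmin n n0 w.
have := gap _ (inT n _ n0 inhat) hw; have := min0 _ Tstar; lra.
Unshelve. all: by end_near. Qed.
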